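(* Let $\alpha: I\to\mathbb{R}^3$ be a general helix parametrized by arc-length $s$, with nowhere vanishing curvature and torsion, unit tangent vector $T$ and unit binormal vector $B$. Let $\sigma=\int_0^s\|B'(s)\|\,ds$ be the arc-length parameter of the binormal indicatrix of $\alpha$, and regard $T$ and $B$ as functions of $\sigma$. Let $a,\theta$ be constant real numbers (with $\cot\theta$ defined), let $c\in\mathbb{R}^3$ be a constant vector, and let $\sigma_0$ be a fixed parameter value. Then $$\tilde\gamma_B(\sigma)=a\int_{\sigma_0}^{\sigma}B(\sigma)\,d\sigma+a\cot\theta\int_{\sigma_0}^{\sigma}T(\sigma)\,d\sigma+c$$ is both a Bertrand curve and a circular helix.
   Context: For a unit speed curve $\alpha$ in $\mathbb{R}^3$: $T=\alpha'$, the curvature is $\kappa=\|\alpha''\|$, and where $\kappa\neq0$ the unit principal normal $N$ is defined by $\alpha''=\kappa N$ and the unit binormal is $B=T\times N$. The torsion $\tau$ is defined by the Frenet-Serret formulae $T'=\kappa N$, $N'=-\kappa T+\tau B$, $B'=-\tau N$. The binormal indicatrix $(B)$ is the curve on the unit sphere $\mathbb{S}^2$ traced by $B(s)$. A general helix is a curve whose unit tangent makes a constant angle with a fixed direction: there is a constant vector $u$ such that $T\cdot u=\cos\phi$ is constant along the curve; by Lancret's theorem this holds iff $\kappa/\tau$ is constant, where $\tau\ne0$. A circular helix is a curve for which both $\kappa$ and $\tau$ are non-zero constants. Convention: curves are regular and, wherever the Frenet frame is used, have nowhere vanishing curvature; this applies also to the curve $\tilde\gamma_B$ (i.e. $a,\theta$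 are such that it is a regular curve with nonvanishing curvature). A Bertrand curve is a curve in $\mathbb{R}^3$ which shares its principal normals with another curve (its Bertrand mate). The characterization used in the paper: a curve with curvature $\kappa$ and torsion $\tau$ is a Bertrand curve if and only if there exist non-zero real numbers $A,B$ such that $A\kappa+B\tau=1$ at every parameter value.
   Formalization: The circular helix conclusion is asserted only when the torsion of the curve is not identically zero: if cot θ = −κ/τ the curve is an arc of a circle, with zero torsion, so the claim fails there. The Bertrand conclusion is kept in all cases. *)

(* Defs.v *)
(* Stdlib reals with Coquelicot. *)
From Stdlib Require Import Reals.
From Coquelicot Require Import Coquelicot.
Open Scope R_scope.

(* Vector addition and scaling are Coquelicot's [plus] and [scal] on products. *)
Notation vec3 := (R * R * R)%type.

Definition cx (v : vec3) : R := fst (fst v).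
Definition cy (v : vec3) : R := snd (fst v).
Definition cz (v : vec3) : R := snd v.

Definition dot (v w : vec3) : R := cx v * cx w + cy v * cy w + cz v * cz w.

Definition cross (v w : vec3) : vec3 :=
  (cy v * cz w - cz v * cy w,
   cz v * cx w - cx v * cz w,
   cx v * cy w - cy v * cx w).

(* Equal to Coquelicot's [norm] on R * R * R, but stated as sqrt (v . v). *)
Definition enorm (v : vec3) : R := sqrt (dot v v).

(* Coquelicot has a total derivative only for real functions, and no complete
   normed module structure on products (needed by [RInt]), so both operations
   are taken coordinatewise. *)
Definition vDerive (f : R -> vec3) (t : R) : vec3 :=
  (Derive (fun x => cx (f x)) t,
   Derive (fun x => cy (f x)) t,
   Derive (fun x => cz (f x)) t).

Definition vRInt (f : R -> vec3) (a b : R) : vec3 :=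
  (RInt (fun x => cx (f x)) a b,
   RInt (fun x => cy (f x)) a b,
   RInt (fun x => cz (f x)) a b).

(* Meant for an open domain D, since [Derive] is a two-sided derivative. *)
Definition C3_real (D : R -> Prop) (f : R -> R) : Prop :=
  forall t, D t ->
    (forall k : nat, (k <= 3)%nat -> ex_derive_n f k t) /\
    continuous (Derive_n f 3) t.

Definition C3 (D : R -> Prop) (g : R -> vec3) : Prop :=
  C3_real D (fun t => cx (g t)) /\
  C3_real D (fun t => cy (g t)) /\
  C3_real D (fun t => cz (g t)).

Definition speed (g : R -> vec3) (t : R) : R := enorm (vDerive g t).

Definition unit_speed (D : R -> Prop) (g : R -> vec3) : Prop :=
  forall t, D t -> speed g t = 1.

(* Derivative of a vector field f along g with respect to the arc length of g,
   expressed in the given parameter t: df/ds = (1 / |g'|) df/dt.  With it the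
   unit-speed definitions of the Frenet apparatus apply to any regular
   parametrization; for a unit-speed g it is the ordinary derivative. *)
Definition arc_derive (g f : R -> vec3) (t : R) : vec3 :=
  scal (/ speed g t) (vDerive f t).

Definition tangent (g : R -> vec3) : R -> vec3 := arc_derive g g.

Definition curvature (g : R -> vec3) (t : R) : R :=
  enorm (arc_derive g (tangent g) t).

Definition normal (g : R -> vec3) (t : R) : vec3 :=
  scal (/ curvature g t) (arc_derive g (tangent g) t).

Definition binormal (g : R -> vec3) (t : R) : vec3 :=
  cross (tangent g t) (normal g t).

(* From the Frenet equation dB/ds = - tau N, with N a unit vector. *)
Definition torsion (g : R -> vec3) (t : R) : R :=
  - dot (arc_derive g (binormal g) t) (normal g t).

(* C^3 is the least smoothness for which the torsion is defined and
   continuous. *)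
Definition frenet_curve (D : R -> Prop) (g : R -> vec3) : Prop :=
  C3 D g /\
  (forall t, D t -> speed g t <> 0) /\
  (forall t, D t -> curvature g t <> 0).

Definition general_helix (D : R -> Prop) (g : R -> vec3) : Prop :=
  exists (u : vec3) (phi : R),
    enorm u = 1 /\ forall t, D t -> dot (tangent g t) u = cos phi.

Definition circular_helix (D : R -> Prop) (g : R -> vec3) : Prop :=
  frenet_curve D g /\
  exists k tau : R,
    k <> 0 /\ tau <> 0 /\
    forall t, D t -> curvature g t = k /\ torsion g t = tau.

Definition normal_line (g : R -> vec3) (t : R) (p : vec3) : Prop :=
  exists r : R, p = plus (g t) (scal r (normal g t)).

(* The mate is parametrized by the correspondence of points, so b need not have
   the same speed as g.  On an interval the distance between corresponding
   points of mates is constant, hence mates that differ somewhere differ at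
   every parameter. *)
Definition bertrand_mate (D : R -> Prop) (g b : R -> vec3) : Prop :=
  frenet_curve D b /\
  (forall t, D t -> b t <> g t) /\
  (forall t, D t -> forall p : vec3, normal_line g t p <-> normal_line b t p).

Definition bertrand_curve (D : R -> Prop) (g : R -> vec3) : Prop :=
  frenet_curve D g /\ exists b : R -> vec3, bertrand_mate D g b.

Definition open_Rbar_interval (l r : Rbar) (s : R) : Prop :=
  Rbar_lt l s /\ Rbar_lt s r.

(* Arc length of the binormal indicatrix s |-> B(s), measured from s = 0. *)
Definition binormal_arclength (alpha : R -> vec3) (s : R) : R :=
  RInt (fun x => enorm (vDerive (binormal alpha) x)) 0 s.

Definition image (f : R -> R) (D : R -> Prop) (y : R) : Prop :=
  exists x, D x /\ f x = y.

(* [reparametrized D sigma f F]: F is f regarded as a function of sigma; this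
   determines F on [image sigma D] only. *)
Definition reparametrized (D : R -> Prop) (sigma : R -> R)
    (f F : R -> vec3) : Prop :=
  forall s, D s -> F (sigma s) = f s.

Definition gamma_B (a theta sigma0 : R) (c : vec3) (T B : R -> vec3)
    (sigma : R) : vec3 :=
  plus (plus (scal a (vRInt B sigma0 sigma))
             (scal (a * (cos theta / sin theta)) (vRInt T sigma0 sigma)))
       c.

(* Main.v *)
(** The arc length of the binormal indicatrix satisfies [d sigma/ds = |tau|], so
    in the parameter [sigma] the Frenet equations become [T' = (kappa/|tau|) N] and
    [B' = -(tau/|tau|) N].  By Lancret's theorem [tau = mu kappa] with [mu]
    constant, so both coefficients, [lam = 1/|mu|] and [eps = mu/|mu|], are
    constant.  For any curve with [g' = p B + q T], [p] and [q] constant, one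
    gets [g'' = k N] with [k = q lam - p eps], and the curvature and torsion of
    [g] are constant.  A Bertrand mate is [g - k N]: its derivative is again a
    constant combination of [B] and [T], with [k] replaced by
    [k (1 + lam^2 + eps^2) <> 0], whether or not the torsion of [g] vanishes. *)

Require Import Defs.
From Stdlib Require Import Reals Ranalysis5 Lra.
From Coquelicot Require Import Coquelicot.
Open Scope R_scope.

(** * Algebra of dot and cross products *)

Lemma vec3_eq (v w : vec3) :
  cx v = cx w -> cy v = cy w -> cz v = cz w -> v = w.
Proof.
  destruct v as [[x y] z], w as [[x' y'] z']; unfold cx, cy, cz; simpl.
  now intros -> -> ->.
Qed.

Lemma cx_plus (v w : vec3) : cx (plus v w) = cx v + cx w.
Proof. reflexivity. Qed.
Lemma cy_plus (v w : vec3) : cy (plus v w) = cy v + cy w.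
Proof. reflexivity. Qed.
Lemma cz_plus (v w : vec3) : cz (plus v w) = cz v + cz w.
Proof. reflexivity. Qed.
Lemma cx_scal (a : R) (v : vec3) : cx (scal a v) = a * cx v.
Proof. reflexivity. Qed.
Lemma cy_scal (a : R) (v : vec3) : cy (scal a v) = a * cy v.
Proof. reflexivity. Qed.
Lemma cz_scal (a : R) (v : vec3) : cz (scal a v) = a * cz v.
Proof. reflexivity. Qed.
Lemma cx_cross (v w : vec3) : cx (cross v w) = cy v * cz w - cz v * cy w.
Proof. reflexivity. Qed.
Lemma cy_cross (v w : vec3) : cy (cross v w) = cz v * cx w - cx v * cz w.
Proof. reflexivity. Qed.
Lemma cz_cross (v w : vec3) : cz (cross v w) = cx v * cy w - cy v * cx w.
Proof. reflexivity. Qed.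

Ltac to_coords :=
  unfold dot in *;
  repeat rewrite ?cx_plus, ?cy_plus, ?cz_plus, ?cx_scal, ?cy_scal, ?cz_scal,
    ?cx_cross, ?cy_cross, ?cz_cross in *.

Ltac vec_ring := apply vec3_eq; to_coords; ring.
Ltac dot_ring := to_coords; ring.

Lemma dot_sym (v w : vec3) : dot v w = dot w v.
Proof. dot_ring. Qed.

Lemma dot_plus_l (u v w : vec3) : dot (plus u v) w = dot u w + dot v w.
Proof. dot_ring. Qed.

Lemma dot_plus_r (u v w : vec3) : dot w (plus u v) = dot w u + dot w v.
Proof. dot_ring. Qed.

Lemma dot_scal_l (a : R) (v w : vec3) : dot (scal a v) w = a * dot v w.
Proof. dot_ring. Qed.

Lemma dot_scal_r (a : R) (v w : vec3) : dot v (scal a w) = a * dot v w.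
Proof. dot_ring. Qed.

Lemma scal_scal (a b : R) (v : vec3) : scal a (scal b v) = scal (a * b) v.
Proof. vec_ring. Qed.

Lemma dot_pos (v : vec3) : 0 <= dot v v.
Proof. unfold dot. nra. Qed.

Lemma enorm_sqr (v : vec3) : enorm v * enorm v = dot v v.
Proof. apply sqrt_sqrt, dot_pos. Qed.

Lemma enorm_scal_unit (a : R) (v : vec3) :
  dot v v = 1 -> enorm (scal a v) = Rabs a.
Proof.
  intros H; unfold enorm.
  replace (dot (scal a v) (scal a v)) with (a²).
  - apply sqrt_Rsqr_abs.
  - rewrite dot_scal_l, dot_scal_r, H; unfold Rsqr; ring.
Qed.

Lemma cross_cross (u v w : vec3) :
  cross (cross u v) w = plus (scal (dot u w) v) (scal (- dot v w) u).
Proof. vec_ring. Qed.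

Lemma dot_cross_cross (u v : vec3) :
  dot (cross u v) (cross u v) = dot u u * dot v v - dot u v * dot u v.
Proof. dot_ring. Qed.

Lemma dot_cross_l (u v : vec3) : dot u (cross u v) = 0.
Proof. dot_ring. Qed.

Lemma dot_cross_r (u v : vec3) : dot v (cross u v) = 0.
Proof. dot_ring. Qed.

Definition orthonormal (u v : vec3) : Prop :=
  dot u u = 1 /\ dot v v = 1 /\ dot u v = 0.

Lemma orthonormal_cross (u v : vec3) :
  orthonormal u v -> orthonormal (cross u v) u.
Proof.
  intros (Hu & Hv & Huv); repeat split.
  - rewrite dot_cross_cross, Hu, Hv, Huv; ring.
  - exact Hu.
  - rewrite dot_sym; apply dot_cross_l.
Qed.

Lemma orthonormal_cross_cross (u v : vec3) :
  orthonormal u v -> cross (cross u v) u = v.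
Proof.
  intros (Hu & Hv & Huv).
  rewrite cross_cross, Hu, (dot_sym v u), Huv; vec_ring.
Qed.

Lemma orthonormal_cross_r (u v : vec3) :
  orthonormal u v -> cross (cross u v) v = scal (- (1)) u.
Proof.
  intros (Hu & Hv & Huv); rewrite cross_cross, Hv, Huv; vec_ring.
Qed.

Lemma orthonormal_cross_l (u v : vec3) :
  orthonormal u v -> cross u (cross u v) = scal (- (1)) v.
Proof.
  (* Only the [v] on the right is replaced, by [cross (cross u v) u]; what remains is
     anticommutativity of the cross product. *)
  intros O; rewrite <- (orthonormal_cross_cross _ _ O) at 2; vec_ring.
Qed.

Lemma orthonormal_decomp (u v w : vec3) :
  orthonormal u v ->
  w = plus (plus (scal (dot w u) u) (scal (dot w v) v))
           (scal (dot w (cross u v)) (cross u v)).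
Proof.
  intros (Hu & Hv & Huv).
  (* Cramer's rule with the Gram determinant of [u] and [v] as denominator: a polynomial identity
     valid for all vectors, so [ring] settles it before orthonormality is used. *)
  assert (H : scal (dot u u * dot v v - dot u v * dot u v) w =
    plus (plus (scal (dot w u * dot v v - dot u v * dot w v) u)
               (scal (dot w v * dot u u - dot u v * dot w u) v))
         (scal (dot w (cross u v)) (cross u v))) by vec_ring.
  rewrite Hu, Hv, Huv in H.
  replace w with (scal (1 * 1 - 0 * 0) w) at 1 by vec_ring.
  rewrite H; f_equal; vec_ring.
Qed.

(** * Differentiation of vector functions *)

(** Asserts differentiability together with the value, whereas the total function [vDerive] returns
    a value even where no derivative exists. *)
Definition is_vderive (f : R -> vec3) (t : R) (v : vec3) : Prop :=
  is_derive (fun x => cx (f x)) t (cx v) /\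
  is_derive (fun x => cy (f x)) t (cy v) /\
  is_derive (fun x => cz (f x)) t (cz v).

Lemma is_vderive_unique (f : R -> vec3) (t : R) (v : vec3) :
  is_vderive f t v -> vDerive f t = v.
Proof.
  intros (Hx & Hy & Hz); apply vec3_eq; now apply is_derive_unique.
Qed.

Lemma is_vderive_ext_loc (f g : R -> vec3) (t : R) (v : vec3) :
  locally t (fun x => f x = g x) -> is_vderive f t v -> is_vderive g t v.
Proof.
  intros H (Hx & Hy & Hz); split; [|split];
    (eapply is_derive_ext_loc; [|eassumption]);
    (eapply filter_imp; [|exact H]); now intros x ->.
Qed.

Lemma is_derive_value (f : R -> R) (t d e : R) :
  is_derive f t d -> d = e -> is_derive f t e.
Proof. now intros H <-. Qed.

Lemma is_derive_Rmult (f g : R -> R) (t df dg : R) :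
  is_derive f t df -> is_derive g t dg ->
  is_derive (fun x => f x * g x) t (df * g t + f t * dg).
Proof. exact (fun Hf Hg => is_derive_mult f g t df dg Hf Hg Rmult_comm). Qed.

Lemma is_derive_Rplus (f g : R -> R) (t df dg : R) :
  is_derive f t df -> is_derive g t dg ->
  is_derive (fun x => f x + g x) t (df + dg).
Proof. exact (is_derive_plus f g t df dg). Qed.

Lemma is_derive_Rminus (f g : R -> R) (t df dg : R) :
  is_derive f t df -> is_derive g t dg ->
  is_derive (fun x => f x - g x) t (df - dg).
Proof. exact (is_derive_minus f g t df dg). Qed.

Lemma is_vderive_plus (f g : R -> vec3) (t : R) (v w : vec3) :
  is_vderive f t v -> is_vderive g t w ->
  is_vderive (fun x => plus (f x) (g x)) t (plus v w).
Proof.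
  intros (? & ? & ?) (? & ? & ?); split; [|split]; now apply is_derive_Rplus.
Qed.

Lemma is_vderive_scal (h : R -> R) (f : R -> vec3) (t d : R) (v : vec3) :
  is_derive h t d -> is_vderive f t v ->
  is_vderive (fun x => scal (h x) (f x)) t
    (plus (scal d (f t)) (scal (h t) v)).
Proof.
  intros ? (? & ? & ?); split; [|split]; now apply is_derive_Rmult.
Qed.

Lemma is_vderive_scal_const (a : R) (f : R -> vec3) (t : R) (v : vec3) :
  is_vderive f t v -> is_vderive (fun x => scal a (f x)) t (scal a v).
Proof.
  intros H.
  replace (scal a v) with (plus (scal 0 (f t)) (scal a v)) by vec_ring.
  apply (is_vderive_scal (fun _ => a)); auto; exact (is_derive_const _ _).
Qed.

Lemma is_vderive_cross (f g : R -> vec3) (t : R) (v w : vec3) :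
  is_vderive f t v -> is_vderive g t w ->
  is_vderive (fun x => cross (f x) (g x)) t
    (plus (cross v (g t)) (cross (f t) w)).
Proof.
  intros (? & ? & ?) (? & ? & ?); split; [|split];
    (eapply is_derive_value;
     [apply is_derive_Rminus; apply is_derive_Rmult; eassumption
     |to_coords; ring]).
Qed.

Lemma is_derive_dot (f g : R -> vec3) (t : R) (v w : vec3) :
  is_vderive f t v -> is_vderive g t w ->
  is_derive (fun x => dot (f x) (g x)) t (dot v (g t) + dot (f t) w).
Proof.
  intros (? & ? & ?) (? & ? & ?); unfold dot.
  eapply is_derive_value;
    [apply is_derive_Rplus; [apply is_derive_Rplus|]; apply is_derive_Rmult;
     eassumption|cbv beta; ring].
Qed.

Lemma is_derive_dot_l (f : R -> vec3) (u : vec3) (t : R) (v : vec3) :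
  is_vderive f t v -> is_derive (fun x => dot (f x) u) t (dot v u).
Proof.
  intros Hf.
  assert (Hu : is_vderive (fun _ => u) t (0, 0, 0))
    by (split; [|split]; exact (is_derive_const _ _)).
  eapply is_derive_value; [exact (is_derive_dot f _ t _ _ Hf Hu)|].
  unfold dot, cx, cy, cz; simpl; ring.
Qed.

Lemma is_derive_locally_const (f : R -> R) (t d c : R) :
  is_derive f t d -> locally t (fun x => f x = c) -> d = 0.
Proof.
  intros H Hc; rewrite <- (is_derive_unique _ _ _ H).
  apply is_derive_unique, (is_derive_ext_loc (fun _ => c)).
  - eapply filter_imp; [|exact Hc]; auto.
  - exact (is_derive_const _ _).
Qed.

(** Applied to the orthonormality relations of a frame, this yields the linear relations between the
    frame and its derivatives. *)
Lemma is_derive_dot_const (f g : R -> vec3) (t c : R) (v w : vec3) :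
  is_vderive f t v -> is_vderive g t w ->
  locally t (fun x => dot (f x) (g x) = c) ->
  dot v (g t) + dot (f t) w = 0.
Proof.
  intros Hf Hg; apply is_derive_locally_const; now apply is_derive_dot.
Qed.

Lemma is_derive_enorm (f : R -> vec3) (t : R) (v : vec3) :
  is_vderive f t v -> enorm (f t) <> 0 ->
  is_derive (fun x => enorm (f x)) t
    ((dot v (f t) + dot (f t) v) / (2 * enorm (f t))).
Proof.
  intros Hf Hn; apply is_derive_sqrt; [now apply is_derive_dot|].
  rewrite <- enorm_sqr; nra.
Qed.

(** [Derive_n f k] agrees with the given [k]-th derivative on [D] only; since [D] is open, the
    agreement holds near each point, so differentiability and continuity carry over. *)
Lemma C3_real_of_derivs (D : R -> Prop) (f f1 f2 f3 : R -> R) :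
  (forall t, D t -> locally t D) ->
  (forall t, D t -> is_derive f t (f1 t)) ->
  (forall t, D t -> is_derive f1 t (f2 t)) ->
  (forall t, D t -> is_derive f2 t (f3 t)) ->
  (forall t, D t -> continuous f3 t) ->
  C3_real D f.
Proof.
  intros Dopen H1 H2 H3 Hc.
  assert (step : forall h h1 h2 : R -> R,
    (forall t, D t -> h t = h1 t) ->
    (forall t, D t -> is_derive h1 t (h2 t)) ->
    forall t, D t -> is_derive h t (h2 t)).
  { intros h h1 h2 E Hd t Dt; apply (is_derive_ext_loc h1); auto.
    eapply filter_imp; [|exact (Dopen t Dt)].
    intros x Dx; now rewrite E. }
  assert (D1 : forall t, D t -> is_derive (Derive_n f 1) t (f2 t)).
  { apply (step _ f1); auto.
    intros t Dt; apply is_derive_unique; auto. }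
  assert (D2 : forall t, D t -> is_derive (Derive_n f 2) t (f3 t)).
  { apply (step _ f2); auto.
    intros t Dt; apply is_derive_unique, D1, Dt. }
  intros t Dt; split.
  - intros [|[|[|[|k]]]] Hk; simpl.
    + exact I.
    + eexists; apply H1, Dt.
    + eexists; apply D1, Dt.
    + eexists; apply D2, Dt.
    + exfalso; do 3 apply le_S_n in Hk; inversion Hk.
  - apply (continuous_ext_loc _ f3); auto.
    eapply filter_imp; [|exact (Dopen t Dt)].
    intros x Dx; symmetry; apply is_derive_unique, D2, Dx.
Qed.

(** The fourth derivative serves to make the third one continuous. *)
Lemma C3_of_vderivs (D : R -> Prop) (f f1 f2 f3 f4 : R -> vec3) :
  (forall t, D t -> locally t D) ->
  (forall t, D t -> is_vderive f t (f1 t)) ->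
  (forall t, D t -> is_vderive f1 t (f2 t)) ->
  (forall t, D t -> is_vderive f2 t (f3 t)) ->
  (forall t, D t -> is_vderive f3 t (f4 t)) ->
  C3 D f.
Proof.
  intros Dopen H1 H2 H3 H4.
  assert (C : forall h h' : R -> R, (forall t, D t -> is_derive h t (h' t)) ->
    forall t, D t -> continuous h t).
  { intros h h' H t Dt; apply (ex_derive_continuous (V := R_NormedModule)).
    exists (h' t); exact (H t Dt). }
  split; [|split].
  - exact (C3_real_of_derivs D _ (fun t => cx (f1 t)) (fun t => cx (f2 t))
      (fun t => cx (f3 t)) Dopen (fun t Dt => proj1 (H1 t Dt))
      (fun t Dt => proj1 (H2 t Dt)) (fun t Dt => proj1 (H3 t Dt))
      (C _ (fun t => cx (f4 t)) (fun t Dt => proj1 (H4 t Dt)))).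
  - exact (C3_real_of_derivs D _ (fun t => cy (f1 t)) (fun t => cy (f2 t))
      (fun t => cy (f3 t)) Dopen (fun t Dt => proj1 (proj2 (H1 t Dt)))
      (fun t Dt => proj1 (proj2 (H2 t Dt))) (fun t Dt => proj1 (proj2 (H3 t Dt)))
      (C _ (fun t => cy (f4 t)) (fun t Dt => proj1 (proj2 (H4 t Dt))))).
  - exact (C3_real_of_derivs D _ (fun t => cz (f1 t)) (fun t => cz (f2 t))
      (fun t => cz (f3 t)) Dopen (fun t Dt => proj2 (proj2 (H1 t Dt)))
      (fun t Dt => proj2 (proj2 (H2 t Dt))) (fun t Dt => proj2 (proj2 (H3 t Dt)))
      (C _ (fun t => cz (f4 t)) (fun t Dt => proj2 (proj2 (H4 t Dt))))).
Qed.

(** * Curves with constant coefficients in a moving frame *)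

(* [lam] and [eps] are the constant curvature and torsion of the frame
   [T], [B x T], [B]. *)
Definition moving_frame (D : R -> Prop) (T B : R -> vec3)
    (lam eps : R) : Prop :=
  forall t, D t ->
    orthonormal (B t) (T t) /\
    is_vderive T t (scal lam (cross (B t) (T t))) /\
    is_vderive B t (scal (- eps) (cross (B t) (T t))).

(** The remaining Frenet equation [N' = eps B - lam T] for [N = B x T]: the product rule gives
    double cross products, reduced by [N x T = -B] and [B x N = -T]. *)
Lemma moving_frame_normal (D : R -> Prop) (T B : R -> vec3) (lam eps t : R) :
  moving_frame D T B lam eps -> D t ->
  is_vderive (fun x => cross (B x) (T x)) t
    (plus (scal eps (B t)) (scal (- lam) (T t))).
Proof.
  intros F Dt; destruct (F t Dt) as (O & HT & HB).
  assert (E := is_vderive_cross _ _ _ _ _ HB HT).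
  assert (E1 : cross (scal (- eps) (cross (B t) (T t))) (T t)
    = scal (- eps) (cross (cross (B t) (T t)) (T t))) by vec_ring.
  assert (E2 : cross (B t) (scal lam (cross (B t) (T t)))
    = scal lam (cross (B t) (cross (B t) (T t)))) by vec_ring.
  rewrite E1, E2, (orthonormal_cross_r _ _ O), (orthonormal_cross_l _ _ O),
    !scal_scal in E.
  replace eps with (- eps * - (1)) by ring.
  replace (- lam) with (lam * - (1)) by ring.
  exact E.
Qed.

Lemma moving_frame_combination (D : R -> Prop) (T B : R -> vec3)
    (lam eps p q t : R) :
  moving_frame D T B lam eps -> D t ->
  is_vderive (fun x => plus (scal p (B x)) (scal q (T x))) t
    (scal (q * lam - p * eps) (cross (B t) (T t))).
Proof.
  intros F Dt; destruct (F t Dt) as (_ & HT & HB).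
  replace (scal (q * lam - p * eps) (cross (B t) (T t)))
    with (plus (scal p (scal (- eps) (cross (B t) (T t))))
               (scal q (scal lam (cross (B t) (T t))))) by vec_ring.
  now apply is_vderive_plus; apply is_vderive_scal_const.
Qed.

Lemma vDerive_ext (D : R -> Prop) (f g : R -> vec3) (t : R) (v : vec3) :
  (forall t, D t -> locally t D) -> (forall t, D t -> f t = g t) -> D t ->
  is_vderive g t v -> vDerive f t = v.
Proof.
  intros Dopen E Dt H; apply is_vderive_unique.
  apply (is_vderive_ext_loc g); auto.
  eapply filter_imp; [|exact (Dopen t Dt)].
  intros x Dx; now rewrite E.
Qed.

(** The coefficient [q * lam - p * eps] may be zero here, so that [frame_curve_coefficient_neq_0]
    can deduce its non-vanishing from that of the curvature. *)
Lemma frame_curve_acceleration (D : R -> Prop) (T B g : R -> vec3)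
    (lam eps p q t : R) :
  let w := sqrt (p * p + q * q) in
  (forall t, D t -> locally t D) ->
  moving_frame D T B lam eps ->
  (forall t, D t -> is_vderive g t (plus (scal p (B t)) (scal q (T t)))) ->
  D t ->
  speed g t = w /\
  tangent g t = scal (/ w) (plus (scal p (B t)) (scal q (T t))) /\
  arc_derive g (tangent g) t
    = scal (/ w * (/ w * (q * lam - p * eps))) (cross (B t) (T t)).
Proof.
  intros w Dopen F Hg.
  assert (Hspeed : forall t, D t -> speed g t = w).
  { intros x Dx; unfold speed; rewrite (is_vderive_unique _ _ _ (Hg x Dx)).
    destruct (F x Dx) as ((HB & HT & HBT) & _).
    unfold enorm, w; f_equal.
    rewrite !dot_plus_l, !dot_plus_r, !dot_scal_l, !dot_scal_r,
      (dot_sym (T x)), HB, HT, HBT; ring. }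
  assert (Htan : forall t, D t ->
    tangent g t = scal (/ w) (plus (scal p (B t)) (scal q (T t)))).
  { intros x Dx; unfold tangent, arc_derive.
    now rewrite (is_vderive_unique _ _ _ (Hg x Dx)), Hspeed. }
  intros Dt; split; [auto|split; [auto|]].
  unfold arc_derive; rewrite Hspeed by assumption.
  erewrite (vDerive_ext D (tangent g)); [|eassumption|exact Htan|assumption
   |apply is_vderive_scal_const, (moving_frame_combination D T B lam eps);
    assumption].
  now rewrite !scal_scal, Rmult_assoc.
Qed.

(** The acceleration is a constant multiple of [B x T], so the principal normal is [B x T] up to the
    sign [k / Rabs k], and the tangent and binormal of [g] are constant combinations of [B] and
    [T]. *)
Lemma frame_curve_frenet (D : R -> Prop) (T B g : R -> vec3)
    (lam eps p q : R) :
  let k := q * lam - p * eps in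
  (forall t, D t -> locally t D) ->
  moving_frame D T B lam eps ->
  (forall t, D t -> is_vderive g t (plus (scal p (B t)) (scal q (T t)))) ->
  k <> 0 ->
  frenet_curve D g /\
  forall t, D t ->
    normal g t = scal (k / Rabs k) (cross (B t) (T t)) /\
    curvature g t = Rabs k / (p * p + q * q) /\
    torsion g t = (p * lam + q * eps) / (p * p + q * q).
Proof.
  intros k Dopen F Hg Hk.
  (* The placeholder is filled with the whole conclusion of [frame_curve_acceleration], for every
     [t] in [D]. *)
  assert (Hw0 : forall t, D t -> _) by
    exact (fun t => frame_curve_acceleration D T B g lam eps p q t Dopen F Hg).
  fold k in Hw0; cbv zeta in Hw0; set (w := sqrt (p * p + q * q)) in Hw0.
  assert (Hspeed : forall t, D t -> speed g t = w) by apply Hw0.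
  assert (Htan : forall t, D t ->
    tangent g t = scal (/ w) (plus (scal p (B t)) (scal q (T t))))
    by apply Hw0.
  assert (Hpq : 0 < p * p + q * q).
  { destruct (Req_dec p 0) as [Hp|Hp]; [|nra].
    destruct (Req_dec q 0) as [Hq|Hq]; [|nra].
    exfalso; apply Hk; unfold k; rewrite Hp, Hq; ring. }
  assert (Hw : 0 < w) by now apply sqrt_lt_R0.
  assert (Hww : w * w = p * p + q * q) by (apply sqrt_sqrt; lra).
  assert (Hak : 0 < Rabs k) by now apply Rabs_pos_lt.
  assert (Hacc : forall t, D t ->
    arc_derive g (tangent g) t = scal (k / (w * w)) (cross (B t) (T t))).
  { intros t Dt; destruct (Hw0 t Dt) as (_ & _ & ->).
    f_equal; field; lra. }
  assert (HN : forall t, D t ->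
    dot (cross (B t) (T t)) (cross (B t) (T t)) = 1).
  { intros t Dt; destruct (F t Dt) as (O & _).
    apply (orthonormal_cross _ _ O). }
  assert (Hcurv : forall t, D t -> curvature g t = Rabs k / (p * p + q * q)).
  { intros t Dt; unfold curvature; rewrite Hacc, enorm_scal_unit by auto.
    rewrite <- Hww.
    unfold Rdiv; rewrite Rabs_mult, Rabs_inv, (Rabs_pos_eq (w * w)); nra. }
  assert (Hnorm : forall t, D t ->
    normal g t = scal (k / Rabs k) (cross (B t) (T t))).
  { intros t Dt; unfold normal; rewrite Hacc, Hcurv, scal_scal, Hww by auto.
    f_equal; field; lra. }
  assert (Hbin : forall t, D t -> binormal g t =
    scal (/ w * (k / Rabs k)) (plus (scal q (B t)) (scal (- p) (T t)))).
  { intros t Dt; unfold binormal; rewrite Htan, Hnorm by assumption.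
    destruct (F t Dt) as (O & _).
    (* Bilinearity exposes [B x N] and [N x T], the two products whose values [- T] and [- B] are
       known. *)
    transitivity (scal (/ w * (k / Rabs k))
      (plus (scal p (cross (B t) (cross (B t) (T t))))
            (scal (- q) (cross (cross (B t) (T t)) (T t))))); [vec_ring|].
    rewrite (orthonormal_cross_r _ _ O), (orthonormal_cross_l _ _ O).
    vec_ring. }
  assert (Htor : forall t, D t ->
    torsion g t = (p * lam + q * eps) / (p * p + q * q)).
  { intros t Dt; unfold torsion, arc_derive.
    rewrite Hspeed, Hnorm by assumption.
    erewrite (vDerive_ext D (binormal g)); [|eassumption|exact Hbin|assumption
     |apply is_vderive_scal_const, (moving_frame_combination D T B lam eps);
      assumption].
    rewrite !dot_scal_l, !dot_scal_r, HN by assumption.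
    rewrite <- Hww.
    (* The sign of [k] enters once through the binormal and once through the normal, so it cancels
       and the torsion carries no absolute value. *)
    assert (Hkk : k * k = Rabs k * Rabs k).
    { rewrite <- Rabs_mult, Rabs_pos_eq; nra. }
    replace (- (/ w * (/ w * (k / Rabs k) *
        ((- p * lam - q * eps) * (k / Rabs k * 1)))))
      with ((p * lam + q * eps) / (w * w) * (k * k / (Rabs k * Rabs k)))
      by (field; lra).
    rewrite Hkk; field; lra. }
  split; [split; [|split]|auto].
  (* The chain of derivatives is [p B + q T], [k N], [k (eps B - lam T)], and again a constant
     multiple of [N]. *)
  - eapply (C3_of_vderivs D g); [exact Dopen|exact Hg| | |].
    + intros t Dt; apply (moving_frame_combination D T B lam eps); auto.
    + intros t Dt; apply is_vderive_scal_const,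
        (moving_frame_normal D T B lam eps); auto.
    + intros t Dt.
      apply is_vderive_scal_const, (moving_frame_combination D T B lam eps);
        auto.
  - intros t Dt; rewrite Hspeed; auto; lra.
  - intros t Dt; rewrite Hcurv by auto.
    apply Rgt_not_eq, Rdiv_lt_0_compat; assumption.
Qed.

(** * Frenet-Serret formulae for unit-speed curves *)

Lemma C3_vDerive (D : R -> Prop) (g : R -> vec3) (t : R) :
  C3 D g -> D t ->
  is_vderive g t (vDerive g t) /\
  is_vderive (vDerive g) t (vDerive (vDerive g) t) /\
  is_vderive (vDerive (vDerive g)) t (vDerive (vDerive (vDerive g)) t).
Proof.
  intros (Hx & Hy & Hz) Dt.
  destruct (Hx t Dt) as (Kx & _), (Hy t Dt) as (Ky & _),
    (Hz t Dt) as (Kz & _).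
  split; [|split]; (split; [|split]); apply Derive_correct;
    first [exact (Kx 1%nat ltac:(auto)) | exact (Ky 1%nat ltac:(auto))
          | exact (Kz 1%nat ltac:(auto)) | exact (Kx 2%nat ltac:(auto))
          | exact (Ky 2%nat ltac:(auto)) | exact (Kz 2%nat ltac:(auto))
          | exact (Kx 3%nat ltac:(auto)) | exact (Ky 3%nat ltac:(auto))
          | exact (Kz 3%nat ltac:(auto))].
Qed.

Lemma unit_speed_arc_derive (D : R -> Prop) (g f : R -> vec3) (t : R) :
  unit_speed D g -> D t -> arc_derive g f t = vDerive f t.
Proof.
  intros U Dt; unfold arc_derive; rewrite (U t Dt), Rinv_1; vec_ring.
Qed.

(** Class C^3 leaves one derivative for the acceleration, hence, as the curvature is nonzero, for
    the curvature, the normal and the binormal. The equations then come from differentiating the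
    orthonormality relations. *)
Lemma frenet_serret (D : R -> Prop) (g : R -> vec3) :
  (forall t, D t -> locally t D) -> frenet_curve D g -> unit_speed D g ->
  forall t, D t ->
    orthonormal (binormal g t) (tangent g t) /\
    cross (binormal g t) (tangent g t) = normal g t /\
    0 < curvature g t /\ continuous (curvature g) t /\
    is_vderive (tangent g) t (scal (curvature g t) (normal g t)) /\
    is_vderive (binormal g) t (scal (- torsion g t) (normal g t)).
Proof.
  intros Dopen (Hg & _ & Hk) U.
  set (A := vDerive (vDerive g)).
  assert (loc : forall f1 f2 : R -> vec3, (forall t, D t -> f1 t = f2 t) ->
    forall t v, D t -> is_vderive f1 t v -> is_vderive f2 t v).
  { intros f1 f2 E t v Dt; apply is_vderive_ext_loc.
    eapply filter_imp; [|exact (Dopen t Dt)]; exact E. }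
  assert (HT : forall t, D t -> vDerive g t = tangent g t).
  { intros t Dt; symmetry; exact (unit_speed_arc_derive D g g t U Dt). }
  assert (HdT : forall t, D t -> is_vderive (tangent g) t (A t)).
  { intros t Dt; destruct (C3_vDerive D g t Hg Dt) as (_ & H & _).
    exact (loc _ _ HT t _ Dt H). }
  assert (Hacc : forall t, D t -> A t = arc_derive g (tangent g) t).
  { intros t Dt; rewrite (unit_speed_arc_derive D) by assumption.
    symmetry; apply is_vderive_unique, HdT, Dt. }
  assert (HdA : forall t, D t -> exists v,
    is_vderive (arc_derive g (tangent g)) t v).
  { intros t Dt; eexists.
    destruct (C3_vDerive D g t Hg Dt) as (_ & _ & H).
    exact (loc _ _ Hacc t _ Dt H). }
  assert (Hpos : forall t, D t -> 0 < curvature g t).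
  { intros t Dt; assert (H := Hk t Dt).
    assert (0 <= curvature g t) by apply sqrt_pos; lra. }
  assert (Hdk : forall t, D t -> exists d, is_derive (curvature g) t d).
  { intros t Dt; destruct (HdA t Dt) as (v & Hv); eexists.
    apply is_derive_enorm; [exact Hv|exact (Hk t Dt)]. }
  assert (HdN : forall t, D t -> exists v, is_vderive (normal g) t v).
  { intros t Dt; destruct (HdA t Dt) as (v & Hv), (Hdk t Dt) as (d & Hd).
    eexists; apply (is_vderive_scal (fun x => / curvature g x)); [|exact Hv].
    apply is_derive_inv; [exact Hd|apply Hk, Dt]. }
  assert (HdB : forall t, D t ->
    is_vderive (binormal g) t (vDerive (binormal g) t)).
  { intros t Dt; destruct (HdN t Dt) as (v & Hv).
    assert (H := is_vderive_cross _ _ _ _ _ (HdT t Dt) Hv).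
    erewrite is_vderive_unique; exact H. }
  assert (HkN : forall t, D t -> A t = scal (curvature g t) (normal g t)).
  { intros t Dt; unfold normal; rewrite Hacc, scal_scal by assumption.
    replace (curvature g t * / curvature g t) with 1 by (field; auto).
    vec_ring. }
  assert (HTT : forall t, D t -> dot (tangent g t) (tangent g t) = 1).
  { intros t Dt; rewrite <- (HT t Dt), <- enorm_sqr.
    assert (H := U t Dt); unfold speed in H; rewrite H; ring. }
  assert (HTA : forall t, D t -> dot (A t) (tangent g t) = 0).
  { intros t Dt.
    assert (H := is_derive_dot_const _ _ t 1 _ _ (HdT t Dt) (HdT t Dt)).
    rewrite (dot_sym (tangent g t)) in H.
    enough (dot (A t) (tangent g t) + dot (A t) (tangent g t) = 0) by lra.
    apply H; eapply filter_imp; [|exact (Dopen t Dt)]; exact HTT. }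
  assert (HTN : forall t, D t -> orthonormal (tangent g t) (normal g t)).
  { intros t Dt; assert (K := Hpos t Dt); repeat split.
    - auto.
    - unfold normal; rewrite dot_scal_l, dot_scal_r, <- enorm_sqr.
      fold (curvature g t); field; lra.
    - assert (H := HTA t Dt).
      rewrite HkN, dot_scal_l, dot_sym in H by assumption; nra. }
  assert (HBT : forall t, D t -> orthonormal (binormal g t) (tangent g t))
    by (intros; apply orthonormal_cross, HTN; assumption).
  assert (HBN : forall t, D t ->
    cross (binormal g t) (tangent g t) = normal g t)
    by (intros; apply orthonormal_cross_cross, HTN; assumption).
  intros t Dt; split; [auto|]; split; [auto|]; split; [auto|]; split; [|split].
  - destruct (Hdk t Dt) as (d & Hd).
    apply (ex_derive_continuous (V := R_NormedModule)); exists d; exact Hd.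
  - rewrite <- HkN; auto.
  - assert (H := HdB t Dt).
    enough (E : scal (- torsion g t) (normal g t) = vDerive (binormal g) t)
      by now rewrite E.
    (* [B'] is expanded in the frame [B], [T], [N]. Its [B] component vanishes because [B . B = 1],
       its [T] component because [B' . T = - kappa (B . N) = 0]; the [N] component is [- tau] by
       definition. *)
    rewrite (orthonormal_decomp _ _ (vDerive (binormal g) t) (HBT t Dt)).
    rewrite HBN by assumption.
    assert (E1 : dot (vDerive (binormal g) t) (binormal g t) = 0).
    { assert (K := is_derive_dot_const _ _ t 1 _ _ H H).
      rewrite (dot_sym (binormal g t)) in K.
      enough (dot (vDerive (binormal g) t) (binormal g t)
        + dot (vDerive (binormal g) t) (binormal g t) = 0) by lra.
      apply K; eapply filter_imp; [|exact (Dopen t Dt)]; apply HBT. }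
    assert (E2 : dot (vDerive (binormal g) t) (tangent g t) = 0).
    { assert (K := is_derive_dot_const _ _ t 0 _ _ H (HdT t Dt)).
      rewrite HkN, dot_scal_r in K by assumption.
      replace (dot (binormal g t) (normal g t)) with 0 in K
        by (symmetry; rewrite dot_sym; apply dot_cross_r).
      rewrite Rmult_0_r, Rplus_0_r in K.
      apply K; eapply filter_imp; [|exact (Dopen t Dt)]; apply HBT. }
    unfold torsion; rewrite (unit_speed_arc_derive D) by assumption.
    rewrite E1, E2; vec_ring.
Qed.

(** * Lancret's theorem *)

Lemma zero_derive_const (f : R -> R) (x y : R) :
  (forall z, Rmin x y <= z <= Rmax x y -> is_derive f z 0) -> f x = f y.
Proof.
  intros H.
  destruct (MVT_gen f x y (fun _ => 0)) as (z & _ & E).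
  - intros z Hz; apply H; lra.
  - intros z Hz; apply continuity_pt_filterlim.
    apply (ex_derive_continuous (V := R_NormedModule)).
    exists 0; apply H, Hz.
  - lra.
Qed.

(** [Rmin] and [Rmax] allow the endpoints in either order, matching the hypotheses of the mean value
    theorem and of integrability. *)
Definition convex_set (D : R -> Prop) : Prop :=
  forall x y z, D x -> D y -> Rmin x y <= z <= Rmax x y -> D z.

(** Differentiating [T . u = cos phi] gives [N . u = 0]; then [(B . u)' = - tau (N . u) = 0], so
    [B . u] is a constant [c2]; differentiating [N . u = 0] gives [tau c2 = kappa cos phi]. The
    ratio is [cos phi / c2]. *)
Lemma lancret (D : R -> Prop) (g : R -> vec3) (t0 : R) :
  (forall t, D t -> locally t D) -> convex_set D -> D t0 ->
  frenet_curve D g -> unit_speed D g -> general_helix D g ->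
  exists mu, forall t, D t -> torsion g t = mu * curvature g t.
Proof.
  intros Dopen Dconv D0 Hg U (u & phi & Hu & Hphi).
  assert (FS := frenet_serret D g Dopen Hg U).
  assert (HNu : forall t, D t -> dot (normal g t) u = 0).
  { intros t Dt; destruct (FS t Dt) as (_ & _ & Hk & _ & HdT & _).
    assert (H := is_derive_locally_const _ _ _ (cos phi)
      (is_derive_dot_l _ u _ _ HdT)).
    rewrite dot_scal_l in H.
    enough (curvature g t * dot (normal g t) u = 0) by nra.
    apply H; eapply filter_imp; [|exact (Dopen t Dt)]; exact Hphi. }
  assert (HBu : forall t, D t -> dot (binormal g t) u = dot (binormal g t0) u).
  { intros t Dt; apply (zero_derive_const (fun x => dot (binormal g x) u)).
    intros z Hz; assert (Dz : D z) by exact (Dconv _ _ _ Dt D0 Hz).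
    destruct (FS z Dz) as (_ & _ & _ & _ & _ & HdB).
    eapply is_derive_value;
      [exact (is_derive_dot_l _ u _ _ HdB)|].
    rewrite dot_scal_l, HNu by assumption; ring. }
  set (c2 := dot (binormal g t0) u) in *.
  (* [N] is differentiated as [B x T], which produces [N' = tau B - kappa T]. *)
  assert (Hrel : forall t, D t -> torsion g t * c2 = curvature g t * cos phi).
  { intros t Dt; destruct (FS t Dt) as (O & EN & Hk & _ & HdT & HdB).
    assert (HdN := is_vderive_cross _ _ _ _ _ HdB HdT).
    assert (H := is_derive_locally_const _ _ _ 0 (is_derive_dot_l _ u _ _ HdN)).
    assert (E1 := orthonormal_cross_r _ _ O).
    assert (E2 := orthonormal_cross_l _ _ O).
    rewrite EN in E1, E2.
    replace (plus (cross (scal (- torsion g t) (normal g t)) (tangent g t))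
        (cross (binormal g t) (scal (curvature g t) (normal g t))))
      with (plus (scal (- torsion g t) (cross (normal g t) (tangent g t)))
        (scal (curvature g t) (cross (binormal g t) (normal g t)))) in H
      by vec_ring.
    rewrite E1, E2, dot_plus_l, !dot_scal_l, (HBu t Dt), (Hphi t Dt) in H.
    enough (- torsion g t * (- (1) * c2)
      + curvature g t * (- (1) * cos phi) = 0) by lra.
    apply H; eapply filter_imp; [|exact (Dopen t Dt)].
    intros x Dx; destruct (FS x Dx) as (_ & EN' & _).
    rewrite EN'; auto. }
  (* Otherwise [cos phi = 0] as well, and [u] would be orthogonal to all three frame vectors,
     contrary to its unit length. *)
  assert (Hc2 : c2 <> 0).
  { intros Hc.
    destruct (FS t0 D0) as (O & EN & Hk & _).
    assert (Hcos : cos phi = 0).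
    { assert (H := Hrel t0 D0); rewrite Hc in H; nra. }
    assert (Huu : dot u u = 1) by (rewrite <- enorm_sqr, Hu; ring).
    rewrite (orthonormal_decomp _ _ u O), EN in Huu.
    rewrite !(dot_sym u), (HNu t0 D0), (Hphi t0 D0), Hcos in Huu.
    fold c2 in Huu; rewrite Hc in Huu.
    revert Huu; to_coords; lra. }
  exists (cos phi / c2); intros t Dt.
  assert (H := Hrel t Dt).
  apply (Rmult_eq_reg_r c2); [|assumption].
  rewrite H; field; assumption.
Qed.

(** * Change of parameter along an increasing function *)

(** The estimate is free of quotients, so the increments of two functions can be compared without
    dividing by either. *)
Lemma is_derive_eps_delta (f : R -> R) (x l : R) :
  is_derive f x l <->
  forall eps, 0 < eps -> exists delta, 0 < delta /\
    forall y, Rabs (y - x) < delta ->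
      Rabs (f y - f x - l * (y - x)) <= eps * Rabs (y - x).
Proof.
  rewrite is_derive_Reals; split.
  - intros H eps Heps; destruct (H eps Heps) as (delta & Hd).
    exists delta; split; [apply cond_pos|].
    intros y Hy; destruct (Req_dec y x) as [->|Hyx].
    { rewrite !Rminus_diag, Rmult_0_r, Rminus_diag, Rabs_R0; lra. }
    assert (K := Hd (y - x) ltac:(lra) Hy).
    replace (x + (y - x)) with y in K by ring.
    replace (f y - f x - l * (y - x))
      with (((f y - f x) / (y - x) - l) * (y - x)) by (field; lra).
    rewrite Rabs_mult; apply Rmult_le_compat_r; [apply Rabs_pos|lra].
  - intros H eps Heps; destruct (H (eps / 2) ltac:(lra)) as (delta & Hd & K).
    exists (mkposreal delta Hd); intros h Hh Hlt; simpl in Hlt.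
    assert (E := K (x + h)); replace (x + h - x) with h in E by ring.
    specialize (E Hlt).
    assert (Hah := Rabs_pos_lt h Hh).
    replace ((f (x + h) - f x) / h - l)
      with ((f (x + h) - f x - l * h) / h) by (field; auto).
    unfold Rdiv; rewrite Rabs_mult, Rabs_inv.
    apply Rle_lt_trans with (eps / 2); [|lra].
    apply (Rmult_le_reg_r (Rabs h)); auto.
    rewrite Rmult_assoc, Rinv_l; lra.
Qed.

Lemma intermediate_value (f : R -> R) (x y v : R) :
  (forall z, Rmin x y <= z <= Rmax x y -> continuous f z) ->
  f x <= v <= f y ->
  exists z, Rmin x y <= z <= Rmax x y /\ f z = v.
Proof.
  intros Hf Hv.
  destruct (Rtotal_order x y) as [H|[H|H]].
  - rewrite Rmin_left, Rmax_right in * by lra.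
    destruct (f_interv_is_interv f x y v H Hv) as (z & Hz & E).
    + intros z Hz; apply continuity_pt_filterlim, Hf, Hz.
    + now exists z.
  - subst y; exists x; rewrite Rmin_left, Rmax_left by lra; lra.
  - rewrite Rmin_right, Rmax_left in * by lra.
    (* With [y < x] the larger value sits at the left endpoint; negating [f] restores the order. *)
    destruct (f_interv_is_interv (fun z => - f z) y x (- v) H) as (z & Hz & E).
    + lra.
    + intros z Hz; apply continuity_pt_opp, continuity_pt_filterlim, Hf, Hz.
    + exists z; split; [exact Hz|lra].
Qed.

Lemma convex_image (D : R -> Prop) (f : R -> R) :
  convex_set D -> (forall x, D x -> continuous f x) ->
  convex_set (image f D).
Proof.
  intros Dconv Hf ? ? v (x & Dx & <-) (y & Dy & <-) Hv.
  assert (main : forall x y, D x -> D y -> f x <= v <= f y -> image f D v).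
  { clear x y Dx Dy Hv; intros x y Dx Dy Hv.
    destruct (intermediate_value f x y v) as (z & Hz & E); auto.
    - intros z Hz; exact (Hf z (Dconv _ _ _ Dx Dy Hz)).
    - exists z; split; [exact (Dconv _ _ _ Dx Dy Hz)|exact E]. }
  destruct (Rle_dec (f x) (f y)).
  - rewrite Rmin_left, Rmax_right in Hv by lra; now apply (main x y).
  - rewrite Rmin_right, Rmax_left in Hv by lra; now apply (main y x).
Qed.

Lemma locally_R_delta (x : R) (P : R -> Prop) :
  locally x P <->
  exists delta, 0 < delta /\ forall y, Rabs (y - x) < delta -> P y.
Proof.
  split.
  - intros (delta & H); exists delta; split; [apply cond_pos|exact H].
  - intros (delta & Hd & H); exists (mkposreal delta Hd); exact H.
Qed.

(** With error tolerance [d / 2], [f] moves by at least [d / 2 * h] on each side of [x], and the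
    intermediate value theorem fills the values in between. *)
Lemma increasing_local_image (f : R -> R) (x d delta : R) :
  is_derive f x d -> 0 < d -> locally x (continuous f) -> 0 < delta ->
  locally (f x) (fun v => exists y, Rabs (y - x) < delta /\ f y = v).
Proof.
  intros Hd dpos Hc Hdelta.
  destruct (proj1 (is_derive_eps_delta f x d) Hd (d / 2)) as (d1 & Hd1 & K);
    [lra|].
  apply locally_R_delta in Hc; destruct Hc as (d2 & Hd2 & Hc).
  (* Half the minimum keeps [x - h] and [x + h] strictly inside all three neighbourhoods. *)
  set (h := Rmin delta (Rmin d1 d2) / 2).
  assert (Hh : 0 < h < delta /\ h < d1 /\ h < d2).
  { assert (0 < Rmin delta (Rmin d1 d2)) by (repeat apply Rmin_pos; auto).
    assert (H1 := Rmin_l delta (Rmin d1 d2)).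
    assert (H2 := Rmin_r delta (Rmin d1 d2)).
    assert (H3 := Rmin_l d1 d2); assert (H4 := Rmin_r d1 d2).
    unfold h; lra. }
  assert (Hup : d / 2 * h <= f (x + h) - f x).
  { assert (E := K (x + h)); replace (x + h - x) with h in E by ring.
    rewrite (Rabs_pos_eq h) in E by lra.
    assert (E' := E ltac:(lra)); apply Rabs_le_between in E'; lra. }
  assert (Hlo : d / 2 * h <= f x - f (x - h)).
  { assert (E := K (x - h)); replace (x - h - x) with (- h) in E by ring.
    rewrite Rabs_Ropp, (Rabs_pos_eq h) in E by lra.
    assert (E' := E ltac:(lra)); apply Rabs_le_between in E'; lra. }
  apply locally_R_delta; exists (d / 2 * h); split; [nra|].
  intros v Hv; apply Rabs_lt_between in Hv.
  destruct (intermediate_value f (x - h) (x + h) v) as (z & Hz & E).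
  - intros z Hz; rewrite Rmin_left, Rmax_right in Hz by lra.
    apply Hc, Rabs_lt_between; lra.
  - lra.
  - rewrite Rmin_left, Rmax_right in Hz by lra.
    exists z; split; [apply Rabs_lt_between; lra|exact E].
Qed.

(* No inverse of [sigma] is needed: every point near [sigma s] is some
   [sigma x] with [x] near [s]. *)
Lemma is_derive_reparametrized (sigma F f : R -> R) (s d l : R) :
  is_derive sigma s d -> 0 < d -> locally s (continuous sigma) ->
  locally s (fun x => F (sigma x) = f x) -> is_derive f s l ->
  is_derive F (sigma s) (l / d).
Proof.
  intros Hs dpos Hc HF Hf; apply is_derive_eps_delta; intros eps Heps.
  set (m := Rabs (l / d)).
  assert (Hm : 0 <= m) by apply Rabs_pos.
  (* The first bound gives [|sigma x - sigma s| >= d / 2 * |x - s|]; the second keeps the total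
     error [e * (1 + m) * |x - s|] below [eps * (d / 2 * |x - s|)]. *)
  set (e := Rmin (d / 2) (eps * d / (2 * (1 + m)))).
  assert (He1 : e <= d / 2) by apply Rmin_l.
  assert (He2 : e * (1 + m) <= eps * d / 2).
  { assert (H : e <= eps * d / (2 * (1 + m))) by apply Rmin_r.
    apply (Rmult_le_compat_r (1 + m)) in H; [|lra].
    replace (eps * d / (2 * (1 + m)) * (1 + m)) with (eps * d / 2) in H
      by (field; lra).
    exact H. }
  assert (He : 0 < e).
  { apply Rmin_pos; [lra|apply Rdiv_lt_0_compat; nra]. }
  destruct (proj1 (is_derive_eps_delta _ _ _) Hs e He) as (d1 & Hd1 & K1).
  destruct (proj1 (is_derive_eps_delta _ _ _) Hf e He) as (d2 & Hd2 & K2).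
  assert (HFs : F (sigma s) = f s) by exact (locally_singleton _ _ HF).
  apply locally_R_delta in HF; destruct HF as (d3 & Hd3 & K3).
  set (delta := Rmin d1 (Rmin d2 d3)).
  assert (Hdelta : 0 < delta) by (repeat apply Rmin_pos; auto).
  assert (L1 : delta <= d1) by apply Rmin_l.
  assert (L2 : delta <= Rmin d2 d3) by apply Rmin_r.
  assert (L3 := Rmin_l d2 d3); assert (L4 := Rmin_r d2 d3).
  assert (Him := increasing_local_image sigma s d delta Hs dpos Hc Hdelta).
  apply locally_R_delta in Him; destruct Him as (d4 & Hd4 & K4).
  exists d4; split; [exact Hd4|].
  intros v Hv; destruct (K4 v Hv) as (x & Hx & <-).
  rewrite K3, HFs by lra.
  assert (E1 := K1 x ltac:(lra)); assert (E2 := K2 x ltac:(lra)).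
  set (ax := Rabs (x - s)) in *.
  assert (Hax : 0 <= ax) by apply Rabs_pos.
  assert (Hlow : d / 2 * ax <= Rabs (sigma x - sigma s)).
  { assert (T := Rabs_triang_inv (d * (x - s))
      (d * (x - s) - (sigma x - sigma s))).
    rewrite Rabs_mult, (Rabs_pos_eq d), (Rabs_minus_sym (d * (x - s))) in T
      by lra.
    replace (d * (x - s) - (d * (x - s) - (sigma x - sigma s)))
      with (sigma x - sigma s) in T by ring.
    fold ax in T; nra. }
  (* The error splits into that of [f] and [l / d] times that of [sigma]; the linear terms
     cancel. *)
  replace (f x - f s - l / d * (sigma x - sigma s))
    with ((f x - f s - l * (x - s))
      + - (l / d) * (sigma x - sigma s - d * (x - s))) by (field; lra).
  eapply Rle_trans; [apply Rabs_triang|].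
  rewrite Rabs_mult, Rabs_Ropp; fold m.
  apply Rle_trans with (e * (1 + m) * ax); [nra|].
  apply Rle_trans with (eps * d / 2 * ax); [nra|].
  replace (eps * d / 2 * ax) with (eps * (d / 2 * ax)) by field.
  apply Rmult_le_compat_l; lra.
Qed.

Lemma is_vderive_reparametrized (sigma : R -> R) (F f : R -> vec3)
    (s d : R) (v : vec3) :
  is_derive sigma s d -> 0 < d -> locally s (continuous sigma) ->
  locally s (fun x => F (sigma x) = f x) -> is_vderive f s v ->
  is_vderive F (sigma s) (scal (/ d) v).
Proof.
  intros Hs dpos Hc HF (Hx & Hy & Hz).
  split; [|split]; rewrite ?cx_scal, ?cy_scal, ?cz_scal, Rmult_comm;
    (eapply (is_derive_reparametrized sigma); [exact Hs|exact dpos|exact Hc|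
     eapply filter_imp; [|exact HF]; intros x E; cbv beta; rewrite E;
       reflexivity|
     eassumption]).
Qed.

(** * Integrals with a variable endpoint, and open intervals *)

Lemma is_derive_RInt_continuous_on (D : R -> Prop) (f : R -> R) (x0 x : R) :
  (forall t, D t -> locally t D) -> convex_set D ->
  (forall t, D t -> continuous f t) -> D x0 -> D x ->
  is_derive (fun y => RInt f x0 y) x (f x).
Proof.
  intros Dopen Dconv Hf D0 Dx.
  refine (is_derive_RInt f _ x0 x _ (Hf x Dx)).
  eapply filter_imp; [|exact (Dopen x Dx)]; intros y Dy.
  apply @RInt_correct, @ex_RInt_continuous.
  intros z Hz; exact (Hf z (Dconv _ _ _ D0 Dy Hz)).
Qed.

Lemma is_vderive_vRInt (D : R -> Prop) (f f' : R -> vec3) (x0 x : R) :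
  (forall t, D t -> locally t D) -> convex_set D ->
  (forall t, D t -> is_vderive f t (f' t)) -> D x0 -> D x ->
  is_vderive (vRInt f x0) x (f x).
Proof.
  intros Dopen Dconv Hf D0 Dx.
  assert (C : forall h h' : R -> R, (forall t, D t -> is_derive h t (h' t)) ->
    is_derive (fun y => RInt h x0 y) x (h x)).
  { intros h h' H; apply (is_derive_RInt_continuous_on D); auto.
    intros t Dt; apply (ex_derive_continuous (V := R_NormedModule)).
    exists (h' t); exact (H t Dt). }
  split; [|split];
    [apply (C (fun y => cx (f y)) (fun y => cx (f' y)))
    |apply (C (fun y => cy (f y)) (fun y => cy (f' y)))
    |apply (C (fun y => cz (f y)) (fun y => cz (f' y)))];
    intros t Dt; destruct (Hf t Dt) as (Hx & Hy & Hz); assumption.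
Qed.

Lemma open_Rbar_interval_open (l r : Rbar) (s : R) :
  open_Rbar_interval l r s -> locally s (open_Rbar_interval l r).
Proof.
  intros (Hl & Hr).
  exact (filter_and _ _ (open_Rbar_gt l s Hl) (open_Rbar_lt r s Hr)).
Qed.

Lemma open_Rbar_interval_convex (l r : Rbar) :
  convex_set (open_Rbar_interval l r).
Proof.
  intros x y z (Hx1 & Hx2) (Hy1 & Hy2) Hz; split.
  - apply Rbar_lt_le_trans with (Rmin x y); [|exact (proj1 Hz)].
    now apply Rmin_case.
  - apply Rbar_le_lt_trans with (Rmax x y); [exact (proj2 Hz)|].
    now apply Rmax_case.
Qed.

(** * Bertrand mates and the curve [gamma_B] *)

(** The mate is displaced along [B x T] and its derivative is again a constant combination of [B]
    and [T], so both principal normals are [B x T] up to sign and the normal lines coincide. *)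
Lemma frame_curve_bertrand (D : R -> Prop) (T B g : R -> vec3)
    (lam eps p q : R) :
  let k := q * lam - p * eps in
  (forall t, D t -> locally t D) ->
  moving_frame D T B lam eps ->
  (forall t, D t -> is_vderive g t (plus (scal p (B t)) (scal q (T t)))) ->
  k <> 0 ->
  bertrand_curve D g.
Proof.
  intros k Dopen F Hg Hk.
  destruct (frame_curve_frenet D T B g lam eps p q Dopen F Hg Hk)
    as (Fg & Ng).
  set (b := fun t => plus (g t) (scal (- k) (cross (B t) (T t)))).
  assert (Hb : forall t, D t -> is_vderive b t
    (plus (scal (p - k * eps) (B t)) (scal (q + k * lam) (T t)))).
  { intros t Dt.
    replace (plus (scal (p - k * eps) (B t)) (scal (q + k * lam) (T t)))
      with (plus (plus (scal p (B t)) (scal q (T t)))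
        (scal (- k) (plus (scal eps (B t)) (scal (- lam) (T t)))))
      by vec_ring.
    apply is_vderive_plus; [auto|].
    apply is_vderive_scal_const, (moving_frame_normal D); auto. }
  set (k' := (q + k * lam) * lam - (p - k * eps) * eps).
  assert (Hk' : k' <> 0).
  { replace k' with (k * (1 + lam * lam + eps * eps)) by (unfold k', k; ring).
    apply Rmult_integral_contrapositive_currified; [exact Hk|nra]. }
  destruct (frame_curve_frenet D T B b lam eps _ _ Dopen F Hb Hk')
    as (Fb & Nb); fold k k' in Ng, Nb.
  assert (sgn : forall x, x <> 0 -> x / Rabs x <> 0).
  { intros x Hx; apply Rmult_integral_contrapositive_currified; [exact Hx|].
    now apply Rinv_neq_0_compat, Rabs_no_R0. }
  assert (S1 := sgn k Hk); assert (S2 := sgn k' Hk').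
  split; [exact Fg|]; exists b; split; [exact Fb|split].
  (* The components of the two curves along [B x T] differ by [k]. *)
  - intros t Dt E; destruct (F t Dt) as (O & _).
    destruct (orthonormal_cross _ _ O) as (HN & _).
    assert (E' : dot (b t) (cross (B t) (T t))
      = dot (g t) (cross (B t) (T t))) by now rewrite E.
    unfold b in E'; rewrite dot_plus_l, dot_scal_l, HN in E'; lra.
  - intros t Dt P; destruct (Ng t Dt) as (EN & _), (Nb t Dt) as (EN' & _).
    unfold normal_line; rewrite EN, EN'; unfold b.
    clear Ng Nb EN EN'; revert S1 S2.
    generalize (k / Rabs k) (k' / Rabs k'); intros x0 x1 S1 S2.
    split; intros (x & ->).
    (* With [x0], [x1] the signs of the two normals, this solves [x * x0 = - k + r * x1] for [r];
       the converse solves the same equation for the other parameter. *)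
    + exists ((x * x0 + k) / x1).
      apply vec3_eq; to_coords; field; auto.
    + exists ((x * x1 - k) / x0).
      apply vec3_eq; to_coords; field; auto.
Qed.

Lemma frame_curve_coefficient_neq_0 (D : R -> Prop) (T B g : R -> vec3)
    (lam eps p q t : R) :
  (forall t, D t -> locally t D) ->
  moving_frame D T B lam eps ->
  (forall t, D t -> is_vderive g t (plus (scal p (B t)) (scal q (T t)))) ->
  D t -> curvature g t <> 0 ->
  q * lam - p * eps <> 0.
Proof.
  intros Dopen F Hg Dt Hc Hk; apply Hc; unfold curvature.
  destruct (frame_curve_acceleration D T B g lam eps p q t Dopen F Hg Dt)
    as (_ & _ & ->).
  destruct (F t Dt) as (O & _).
  rewrite enorm_scal_unit by apply (orthonormal_cross _ _ O).
  rewrite Hk, !Rmult_0_r; exact Rabs_R0.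
Qed.

(** Since [B' = - tau N] with [N] a unit vector, the integrand is [|tau| = |mu| kappa] on [D]; its
    continuity comes from that of the curvature. *)
Lemma binormal_arclength_derive (D : R -> Prop) (g : R -> vec3) (mu s : R) :
  (forall t, D t -> locally t D) -> convex_set D -> D 0 ->
  frenet_curve D g -> unit_speed D g ->
  (forall t, D t -> torsion g t = mu * curvature g t) -> D s ->
  is_derive (binormal_arclength g) s (Rabs mu * curvature g s).
Proof.
  intros Dopen Dconv D0 Hg U Hmu Ds.
  assert (FS := frenet_serret D g Dopen Hg U).
  assert (E : forall t, D t ->
    enorm (vDerive (binormal g) t) = Rabs mu * curvature g t).
  { intros t Dt; destruct (FS t Dt) as (O & EN & Hk & _ & _ & HdB).
    rewrite (is_vderive_unique _ _ _ HdB), enorm_scal_unit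
      by (rewrite <- EN; apply (orthonormal_cross _ _ O)).
    rewrite Rabs_Ropp, (Hmu t Dt), Rabs_mult, (Rabs_pos_eq (curvature g t));
      lra. }
  rewrite <- (E s Ds).
  apply (is_derive_RInt_continuous_on D
    (fun x => enorm (vDerive (binormal g) x))); auto.
  intros t Dt.
  apply (continuous_ext_loc _ (fun x => Rabs mu * curvature g x)).
  - eapply filter_imp; [|exact (Dopen t Dt)].
    intros x Dx; symmetry; exact (E x Dx).
  - destruct (FS t Dt) as (_ & _ & _ & Hc & _).
    exact (continuous_scal_r (Rabs mu) (curvature g) t Hc).
Qed.

(** The torsion of [gamma] is a constant which, for [a <> 0], vanishes exactly when
    [cot theta = - 1 / mu], with [mu] the ratio [tau / kappa] of [alpha]. Hence the circular helix
    claim asks for a nonzero torsion at one parameter. *)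
Theorem corollary3 :
  forall (l r : Rbar) (alpha : R -> vec3)
    (T B : R -> vec3) (a theta sigma0 : R) (c : vec3),
  let I := open_Rbar_interval l r in
  let sigma := binormal_arclength alpha in
  let J := image sigma I in
  let gamma := gamma_B a theta sigma0 c T B in
  I 0 ->
  frenet_curve I alpha ->
  unit_speed I alpha ->
  general_helix I alpha ->
  (forall s, I s -> torsion alpha s <> 0) ->
  reparametrized I sigma (tangent alpha) T ->
  reparametrized I sigma (binormal alpha) B ->
  sin theta <> 0 ->
  J sigma0 ->
  (forall u, J u -> speed gamma u <> 0) ->
  (forall u, J u -> curvature gamma u <> 0) ->
  bertrand_curve J gamma /\
  ((exists u, J u /\ torsion gamma u <> 0) -> circular_helix J gamma).
Proof.
  intros l r alpha T B a theta sigma0 c I sigma J gamma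
    I0 Halpha U Hhelix Htau HT HB _ J0 _ Hcurv.
  assert (Iopen : forall s, I s -> locally s I)
    by apply open_Rbar_interval_open.
  assert (Iconv : convex_set I) by apply open_Rbar_interval_convex.
  destruct (lancret I alpha 0 Iopen Iconv I0 Halpha U Hhelix) as (mu & Hmu).
  assert (FS := frenet_serret I alpha Iopen Halpha U).
  assert (mu0 : mu <> 0).
  { intros E; apply (Htau 0 I0); rewrite (Hmu 0 I0), E; ring. }
  assert (Hsigma : forall s, I s ->
      is_derive sigma s (Rabs mu * curvature alpha s))
    by (intros s Is; exact (binormal_arclength_derive I alpha mu s Iopen Iconv
         I0 Halpha U Hmu Is)).
  assert (Hpos : forall s, I s -> 0 < Rabs mu * curvature alpha s).
  { intros s Is; destruct (FS s Is) as (_ & _ & Hk & _).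
    apply Rmult_lt_0_compat; [now apply Rabs_pos_lt|exact Hk]. }
  assert (Csigma : forall s, I s -> continuous sigma s).
  { intros s Is; apply (ex_derive_continuous (V := R_NormedModule)).
    eexists; exact (Hsigma s Is). }
  assert (LC : forall s, I s -> locally s (continuous sigma)).
  { intros s Is; eapply filter_imp; [|exact (Iopen s Is)]; exact Csigma. }
  (* [sigma] has positive derivative, so it maps neighbourhoods onto neighbourhoods. *)
  assert (Jopen : forall u, J u -> locally u J).
  { intros u (s & Is & <-).
    destruct (proj1 (locally_R_delta _ _) (Iopen s Is)) as (delta & Hd & H).
    eapply filter_imp; [|exact (increasing_local_image sigma s _ delta
      (Hsigma s Is) (Hpos s Is) (LC s Is) Hd)].
    intros v (x & Hx & E); exists x; split; [exact (H x Hx)|exact E]. }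
  (* The integrals from [sigma0] therefore stay inside [J], the set on which [T] and [B] are
     determined. *)
  assert (Jconv : convex_set J) by exact (convex_image I sigma Iconv Csigma).
  (* Dividing the Frenet equations of [alpha] by [sigma' = |mu| kappa] cancels [kappa] and leaves
     constant coefficients. *)
  assert (F : moving_frame J T B (/ Rabs mu) (mu / Rabs mu)).
  { intros u (s & Is & <-); destruct (FS s Is) as (O & EN & Hk & _ & HdT & HdB).
    assert (Hm := Rabs_pos_lt mu mu0).
    assert (Loc : forall F f : R -> vec3, reparametrized I sigma f F ->
      locally s (fun x => F (sigma x) = f x)).
    { intros F f H; eapply filter_imp; [|exact (Iopen s Is)]; exact H. }
    rewrite (HT s Is), (HB s Is), EN; split; [exact O|split].
    - replace (scal (/ Rabs mu) (normal alpha s))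
        with (scal (/ (Rabs mu * curvature alpha s))
          (scal (curvature alpha s) (normal alpha s)))
        by (rewrite scal_scal; f_equal; field; lra).
      exact (is_vderive_reparametrized sigma T _ s _ _ (Hsigma s Is)
        (Hpos s Is) (LC s Is) (Loc _ _ HT) HdT).
    - replace (scal (- (mu / Rabs mu)) (normal alpha s))
        with (scal (/ (Rabs mu * curvature alpha s))
          (scal (- torsion alpha s) (normal alpha s)))
        by (rewrite scal_scal, (Hmu s Is); f_equal; field; lra).
      exact (is_vderive_reparametrized sigma B _ s _ _ (Hsigma s Is)
        (Hpos s Is) (LC s Is) (Loc _ _ HB) HdB). }
  set (q := a * (cos theta / sin theta)) in *.
  assert (Hgamma : forall u, J u ->
    is_vderive gamma u (plus (scal a (B u)) (scal q (T u)))).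
  { intros u Ju.
    replace (plus (scal a (B u)) (scal q (T u)))
      with (plus (plus (scal a (B u)) (scal q (T u))) (0, 0, 0))
      by (apply vec3_eq; to_coords; unfold cx, cy, cz; simpl; ring).
    apply (is_vderive_plus (fun v =>
      plus (scal a (vRInt B sigma0 v)) (scal q (vRInt T sigma0 v)))
      (fun _ => c)).
    - assert (dB := is_vderive_vRInt J B _ sigma0 u Jopen Jconv
        (fun t Jt => proj2 (proj2 (F t Jt))) J0 Ju).
      assert (dT := is_vderive_vRInt J T _ sigma0 u Jopen Jconv
        (fun t Jt => proj1 (proj2 (F t Jt))) J0 Ju).
      exact (is_vderive_plus _ _ _ _ _ (is_vderive_scal_const a _ _ _ dB)
        (is_vderive_scal_const q _ _ _ dT)).
    - split; [|split]; exact (is_derive_const _ _). }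
  assert (Hk := frame_curve_coefficient_neq_0 J T B gamma _ _ a q sigma0
    Jopen F Hgamma J0 (Hcurv sigma0 J0)).
  split; [exact (frame_curve_bertrand J T B gamma _ _ a q Jopen F Hgamma Hk)|].
  intros (u & Ju & Htor).
  destruct (frame_curve_frenet J T B gamma _ _ a q Jopen F Hgamma Hk)
    as (Fg & Ng).
  destruct (Ng u Ju) as (_ & Eku & Etu).
  split; [exact Fg|].
  (* The formulas for both quantities do not involve the parameter, so their values at [u] are the
     constants. *)
  exists (curvature gamma u), (torsion gamma u).
  split; [exact (Hcurv u Ju)|split; [exact Htor|]].
  intros t Jt; destruct (Ng t Jt) as (_ & Ek & Et).
  now rewrite Eku, Etu.
Qed.
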